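(* Let $A\in\mathbb{R}^{n\times n}$, $B\in\mathbb{R}^{n\times m}$ with $m\le n$ and $(A,B)$ controllable. Let $X\subseteq\mathbb{R}^n$, $U\subseteq\mathbb{R}^m$ and $W\subseteq\mathbb{R}^n$, $W\ne\emptyset$, each be a finite union of polytopes. Let $\delta\in\mathbb{R}_{>0}$, let $c\in\mathbb{R}_{>0}$ be a constant such that $\varepsilon'\mathbb{B}\subseteq N_n^{c\varepsilon'}$ for all $\varepsilon'\in\mathbb{R}_{>0}$, and put $\varepsilon=\delta/c$. Then the outer approximation scheme terminates, i.e. there is a smallest index $i\in\mathbb{Z}_{\ge0}$ with $R_i\subseteq R_{i+n}+\varepsilon\mathbb{B}$, and for this $i$ one of the following holds: either $R_{i+n}=\emptyset$, in which case $R(X)=\emptyset$; or $R_{i+n}\neq\emptyset$ and the set $$R:=\bigcup_{j\in\{1,\dots,n\}}\bigl(R_{i+j}+N_j^\delta\bigr)$$ is a $\delta$-relaxed robust controlled invariant set, i.e. $R(X)\subseteq R\subseteq X+\delta\mathbb{B}$ and $R$ is robust controlled invariant with respect to the system $\xi(t+1)\in A\xi(t)+B\nu(t)+W$ and $U+\delta\mathbb{B}$.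
   Context: $\mathbb{B}$ denotes the closed unit ball of the infinity norm (in $\mathbb{R}^n$ or $\mathbb{R}^m$ according to context). Polytopes are bounded (compact convex polyhedra). Sums of sets are Minkowski sums (a sum with the empty set is empty), and $x+W$ means $\{x\}+W$. $(A,B)$ is controllable if $[B,AB,\dots,A^{n-1}B]$ has rank $n$. For $R\subseteq\mathbb{R}^n$, $\operatorname{pre}(R)=\{x\in\mathbb{R}^n\mid \exists u\in U:\ Ax+Bu+W\subseteq R\}$. The sequence $(R_i)_{i\in\mathbb{Z}_{\ge0}}$ is defined by $R_0=X$, $R_{i+1}=\operatorname{pre}(R_i)\cap X$. The outer approximation scheme computes $R_0,R_1,\dots$ until the stopping criterion $R_i\subseteq R_{i+n}+\varepsilon\mathbb{B}$ is met. For $\delta\in\mathbb{R}_{>0}$ the sets $N_i^\delta\subseteq\mathbb{R}^n$ are defined by $N_0^\delta=\{0\}$ and $N_{i+1}^\delta=\{x\in\mathbb{R}^n\mid \exists u\in\delta\mathbb{B}:\ Ax+Bu\in N_i^\delta\}\cap\delta\mathbb{B}$, where $u$ ranges over $\delta\mathbb{B}\subseteq\mathbb{R}^m$. A set $S\subseteq\mathbb{R}^n$ is robust controlled invariant with respect to the system $\xi(t+1)\in A\xi(t)+B\nu(t)+W$ and an input constraint set $U'\subseteq\mathbb{R}^m$ if for every $x\in S$ there exists $u\in U'$ with $Ax+Bu+W\subseteq S$. This property is closed under unions, and $R(X)$ denotes the largest subset of $X$ that is robust controlled invariant with respect to the system and $U$ (possibly empty). *)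

(* Defs.v *)
From mathcomp Require Import all_boot all_order all_algebra.
From mathcomp Require Import all_classical all_reals all_analysis.

Set Implicit Arguments.
Unset Strict Implicit.
Unset Printing Implicit Defensive.

Import Order.TTheory GRing.Theory Num.Theory.
Import numFieldNormedType.Exports.

Local Open Scope classical_set_scope.
Local Open Scope ring_scope.

(* The reals are an arbitrary [K : realType]; R^n is ['cV[K]_n]. *)

(* The norm on matrices is the max of the absolute values
   of the entries, i.e. the infinity norm on column vectors. *)
Definition unit_ball (K : realType) (n : nat) : set 'cV[K]_n :=
  [set x | `|x| <= 1].

Definition scale_set (K : realType) (n : nat) (d : K) (S : set 'cV[K]_n) :
    set 'cV[K]_n :=
  [set d *: x | x in S].

Definition scaled_ball (K : realType) (n : nat) (d : K) : set 'cV[K]_n :=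
  scale_set d (@unit_ball K n).
Arguments scaled_ball {K} n d.

Definition minkowski_sum (K : realType) (n : nat) (S T : set 'cV[K]_n) :
    set 'cV[K]_n :=
  [set x + y | x in S & y in T].

(* Finite intersections of closed half-spaces, the whole space ([k = 0]) and
   the empty set included. *)
Definition polyhedron (K : realType) (n : nat) (P : set 'cV[K]_n) : Prop :=
  exists (k : nat) (H : 'M[K]_(k, n)) (h : 'cV[K]_k),
    P = [set x | forall i : 'I_k, (H *m x) i ord0 <= h i ord0].

Definition polytope (K : realType) (n : nat) (P : set 'cV[K]_n) : Prop :=
  polyhedron P /\ compact P.

Definition finite_union_of_polytopes (K : realType) (n : nat)
    (S : set 'cV[K]_n) : Prop :=
  exists (k : nat) (P : 'I_k -> set 'cV[K]_n),
    (forall i, polytope (P i)) /\ S = \bigcup_i P i.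

Definition controllable (K : realType) (n m : nat)
    (A : 'M[K]_n) (B : 'M[K]_(n, m)) : Prop :=
  \rank (\mxrow_(j < n) (A ^+ j *m B)) = n.

Section System.
Variables (K : realType) (n m : nat) (A : 'M[K]_n) (B : 'M[K]_(n, m)).

Definition successors (W : set 'cV[K]_n) (x : 'cV[K]_n) (u : 'cV[K]_m) :
    set 'cV[K]_n :=
  minkowski_sum [set A *m x + B *m u] W.

Definition pre (U : set 'cV[K]_m) (W S : set 'cV[K]_n) : set 'cV[K]_n :=
  [set x | exists2 u, U u & successors W x u `<=` S].

Fixpoint outer_approx (X : set 'cV[K]_n) (U : set 'cV[K]_m)
    (W : set 'cV[K]_n) (i : nat) : set 'cV[K]_n :=
  if i is i'.+1 then pre U W (outer_approx X U W i') `&` X else X.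

Definition stopping_criterion (X : set 'cV[K]_n) (U : set 'cV[K]_m)
    (W : set 'cV[K]_n) (eps : K) (i : nat) : Prop :=
  outer_approx X U W i `<=`
    minkowski_sum (outer_approx X U W (i + n)%N) (scaled_ball n eps).

(* [Nset d i] is N_i^d. *)
Fixpoint Nset (d : K) (i : nat) : set 'cV[K]_n :=
  if i is i'.+1 then
    [set x | exists2 u, scaled_ball m d u & Nset d i' (A *m x + B *m u)]
      `&` scaled_ball n d
  else [set 0].

Definition robust_controlled_invariant (U : set 'cV[K]_m)
    (W S : set 'cV[K]_n) : Prop :=
  forall x, S x -> exists2 u, U u & successors W x u `<=` S.

(* R(X); [max_rciP] below shows that this union is indeed the largest robust
   controlled invariant subset of X. *)
Definition max_rci (X : set 'cV[K]_n) (U : set 'cV[K]_m)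
    (W : set 'cV[K]_n) : set 'cV[K]_n :=
  \bigcup_(S in [set S | S `<=` X /\ robust_controlled_invariant U W S]) S.

Definition relaxed_rci (X : set 'cV[K]_n) (U : set 'cV[K]_m)
    (W : set 'cV[K]_n) (d : K) (S : set 'cV[K]_n) : Prop :=
  [/\ max_rci X U W `<=` S,
      S `<=` minkowski_sum X (scaled_ball n d)
    & robust_controlled_invariant (minkowski_sum U (scaled_ball m d)) W S].

Lemma max_rciP (X : set 'cV[K]_n) (U : set 'cV[K]_m) (W : set 'cV[K]_n) :
  [/\ max_rci X U W `<=` X,
      robust_controlled_invariant U W (max_rci X U W)
    & forall S, S `<=` X -> robust_controlled_invariant U W S ->
        S `<=` max_rci X U W].
Proof.
split=> [x [S [SX _] /SX//]|x [S [SX Sinv] Sx]|S SX Sinv x Sx].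
- have [u Uu uS] := Sinv _ Sx; exists u => // y /uS Sy.
  by exists S.
- by exists S.
Qed.

End System.

(* Main.v *)
Require Import Defs.
From mathcomp Require Import all_boot all_order all_algebra.
From mathcomp Require Import all_classical all_reals all_analysis.

Set Implicit Arguments.
Unset Strict Implicit.
Unset Printing Implicit Defensive.

Import Order.TTheory GRing.Theory Num.Theory.
Import numFieldNormedType.Exports.

Local Open Scope classical_set_scope.
Local Open Scope ring_scope.

(** Termination only uses that [X] is totally bounded: cover it by finitely many
    balls of radius [eps / 2]. The balls met by [R_i] form a decreasing sequence
    of finite sets, which is eventually constant; once every ball met by [R_i]
    is also met by [R_(i+n)], the stopping criterion holds at [i].
    For the invariance of the union of the [R_(i+j) + N_j], a point [r + s] is
    steered by the sum of the inputs chosen for [r] and [s], which sends it to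
    [R_(i+j-1) + N_(j-1)]. For [j = 1] this set is [R_i], and the stopping
    criterion closes the loop:
    [R_i] lies in [R_(i+n) + eps B], hence in [R_(i+n) + N_n^(c eps)]. *)

Lemma compact_finite_union_of_polytopes (K : realType) (n : nat)
    (X : set 'cV[K]_n) : finite_union_of_polytopes X -> compact X.
Proof.
move=> [k [P [Ppoly ->]]].
rewrite (_ : \bigcup_i P i = \big[setU/set0]_(i <- enum 'I_k) P i).
  by apply: bigsetU_compact => i _; case: (Ppoly i).
rewrite -bigcup_seq; congr (bigcup _ P); apply/seteqP.
by split=> i //= _; rewrite mem_enum.
Qed.

Lemma compact_finite_net (K : realType) (V : normedModType K) (X : set V)
    (e : K) : compact X -> 0 < e ->
  exists D : seq V, forall x, X x -> exists2 d, d \in D & ball d e x.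
Proof.
rewrite compact_cover => cX e0.
have [|x Xx|D _ XD] := cX V setT (fun d => ball d e).
- by move=> d _; exact: ball_open.
- by exists x => //; exact: ballxx.
by exists (finmap.enum_fset D) => x /XD [d /= dD dx]; exists d.
Qed.

(** By induction on [D]: an element that fails at some index [M] fails ever after, and one that
    never fails puts no constraint on the index. So the maximum of the finitely many failure indices
    works. *)
Lemma decreasing_seq_stabilizes (T : eqType) (D : seq T)
    (S : nat -> T -> Prop) :
  (forall i j d, (i <= j)%N -> S j d -> S i d) ->
  exists N, forall d, d \in D -> S N d -> forall j, S j d.
Proof.
move=> decS; elim: D => [|a D [N IH]]; first by exists 0%N.
have [[M nSM]|allS] := pselect (exists M, ~ S M a).
  exists (maxn M N) => d; rewrite inE => /orP[/eqP ->|dD] Sd.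
    by case: nSM; apply: decS Sd; rewrite leq_maxl.
  by apply: IH => //; apply: decS Sd; rewrite leq_maxr.
exists N => d; rewrite inE => /orP[/eqP -> _ j|]; last exact: IH.
by apply: contrapT => nSj; apply: allS; exists j.
Qed.

Lemma scaled_ballP (K : realType) (n : nat) (d : K) (x : 'cV[K]_n) :
  0 < d -> scaled_ball n d x <-> `|x| <= d.
Proof.
move=> d0; split=> [[y /= y1 <-]|xd].
  by rewrite normrZ gtr0_norm// ler_piMr// ltW.
exists (d^-1 *: x) => /=; last by rewrite scalerA mulfV ?gt_eqF// scale1r.
by rewrite /unit_ball /= normrZ gtr0_norm ?invr_gt0// ler_pdivrMl ?mulr1.
Qed.

Section OuterApproximation.
Context {K : realType} {n m : nat}.
Variables (A : 'M[K]_n) (B : 'M[K]_(n, m)).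
Variables (X : set 'cV[K]_n) (U : set 'cV[K]_m) (W : set 'cV[K]_n).

Local Notation R := (outer_approx A B X U W).
Local Notation N := (Nset A B).

Lemma outer_approxS_sub i : R i.+1 `<=` R i.
Proof.
elim: i => [|i IH] x; first by case.
by case=> -[u Uu sub] Xx; split=> //; exists u => // y /sub/IH.
Qed.

Lemma outer_approx_decr i j : (i <= j)%N -> R j `<=` R i.
Proof.
move=> /subnK <-; elim: (j - i)%N => [//|k IH].
by rewrite addSn => x /outer_approxS_sub/IH.
Qed.

(** Invariance puts [max_rci] inside its own [pre], and [pre] is monotone. *)
Lemma max_rci_sub_outer_approx i : max_rci A B X U W `<=` R i.
Proof.
have [subX inv _] := max_rciP A B X U W.
elim: i => [//|i IH] x Mx; split; last exact: subX.
by have [u Uu sub] := inv _ Mx; exists u => // y /sub/IH.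
Qed.

Lemma stopping_criterion_terminates (eps : K) : compact X -> 0 < eps ->
  exists i, stopping_criterion A B X U W eps i.
Proof.
move=> cX eps0.
have [D coverD] := compact_finite_net cX (divr_gt0 eps0 (ltr0Sn K 1)).
(* The predicate says that the ball around [d] meets [R i]. *)
have [i meet] := @decreasing_seq_stabilizes _ D
  (fun i d => exists2 y, R i y & ball d (eps / 2) y)
  (fun i j d leij '(ex_intro2 y Ry dy) =>
     ex_intro2 _ _ y (outer_approx_decr leij Ry) dy).
exists i => x Rx; have [d dD dx] := coverD x (outer_approx_decr (leq0n i) Rx).
have [y Ry dy] := meet d dD (ex_intro2 _ _ x Rx dx) (i + n)%N.
exists y => //; exists (x - y); last by rewrite addrC subrK.
apply/scaled_ballP => //; rewrite -[_ - _]opprB normrN ltW//.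
have := ball_splitr dy dx.
by rewrite -ball_normE.
Qed.

Lemma Nset0 (d : K) j : 0 < d -> N d j 0.
Proof.
move=> d0; have b0 k : scaled_ball k d (0 : 'cV[K]_k).
  by apply/scaled_ballP; rewrite ?normr0 ?ltW.
elim: j => [//|j IH]; split=> //; exists 0 => //.
by rewrite !mulmx0 addr0.
Qed.

(** By linearity the motions of [r] and [s] add up. The disturbance is charged to [r] alone, whose
    input [u] copes with every [w]; [s] follows the disturbance-free dynamics under [v]. *)
Lemma relaxed_step (d : K) i j x :
    minkowski_sum (R i.+1) (N d j.+1) x ->
  exists2 u, minkowski_sum U (scaled_ball m d) u &
    successors A B W x u `<=` minkowski_sum (R i) (N d j).
Proof.
case=> r [[u Uu sub] _] [s [[v dv Ns] _] <-].
exists (u + v); first by exists u => //; exists v.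
move=> _ [_ -> [w Ww <-]].
exists (A *m r + B *m u + w).
  by apply: sub; exists (A *m r + B *m u) => //; exists w.
exists (A *m s + B *m v) => //.
by rewrite !mulmxDr addrAC addrACA.
Qed.

Lemma relaxed_rci_outer_approx (d eps : K) i : (0 < n)%N -> 0 < d ->
    scaled_ball n eps `<=` N d n -> stopping_criterion A B X U W eps i ->
  relaxed_rci A B X U W d
    (\bigcup_(j in [set j | (1 <= j <= n)%N])
       minkowski_sum (R (i + j)%N) (N d j)).
Proof.
move=> n0 d0 epsN stop; split.
(* Index 1 is in range because [0 < n], and [0] lies in [N d 1]. *)
- move=> x Mx; exists 1%N => //.
  exists x; first exact: max_rci_sub_outer_approx.
  by exists 0; [exact: Nset0 | rewrite addr0].
(* At a positive index, [N] is cut with the ball of radius [d] by definition. *)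
- move=> x [[//|j] _ [r Rr [s [_ ds] <-]]].
  by exists r; [exact: outer_approx_decr (leq0n _) _ Rr | exists s].
- move=> x [[//|j] /= jn]; rewrite addnS => /relaxed_step [u Uu sub].
  exists u => // y /sub; case: j jn {sub} => [_|j /ltnW jn]; last by exists j.+1.
  (* From index 1 the successor lands in [R i] itself, as [N d 0] is [{0}]; it re-enters the union
     at index [n]. *)
  rewrite addn0 => -[r /stop [r' Rr' [s /epsN Ns <-]]] [_ -> <-].
  rewrite addr0; exists n; first by rewrite /= n0 /=.
  by exists r' => //; exists s.
Qed.

End OuterApproximation.

Theorem mainTheorem5 (K : realType) (n m : nat)
    (A : 'M[K]_n) (B : 'M[K]_(n, m))
    (X : set 'cV[K]_n) (U : set 'cV[K]_m) (W : set 'cV[K]_n)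
    (delta c : K)
    (n_gt0 : (0 < n)%N) (le_mn : (m <= n)%N)
    (ctrlAB : controllable A B)
    (polyX : finite_union_of_polytopes X)
    (polyU : finite_union_of_polytopes U)
    (polyW : finite_union_of_polytopes W)
    (W_neq0 : W !=set0)
    (delta_gt0 : 0 < delta) (c_gt0 : 0 < c)
    (Nc : forall e : K, 0 < e -> scaled_ball n e `<=` Nset A B (c * e) n) :
  exists i : nat,
    [/\ stopping_criterion A B X U W (delta / c) i,
        forall k : nat, (k < i)%N ->
          ~ stopping_criterion A B X U W (delta / c) k
      & (outer_approx A B X U W (i + n)%N = set0 /\
         max_rci A B X U W = set0) \/
        (outer_approx A B X U W (i + n)%N !=set0 /\
         relaxed_rci A B X U W delta
           (\bigcup_(j in [set j | (1 <= j <= n)%N])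
              minkowski_sum (outer_approx A B X U W (i + j)%N)
                (Nset A B delta j)))].
Proof.
have eps_gt0 : 0 < delta / c by exact: divr_gt0.
have ex_stop : exists i, `[< stopping_criterion A B X U W (delta / c) i >].
  have cX := compact_finite_union_of_polytopes polyX.
  have [i stop] := stopping_criterion_terminates A B U W cX eps_gt0.
  by exists i; apply/asboolP.
have [i /asboolP stop mini] := ex_minnP ex_stop.
exists i; split=> //.
  by move=> k ki /asboolP /mini; rewrite leqNgt ki.
have [R0|/set0P RN0] := eqVneq (outer_approx A B X U W (i + n)) set0.
  left; split=> //; rewrite -subset0 -{}R0.
  exact: max_rci_sub_outer_approx.
right; split=> //; apply: (relaxed_rci_outer_approx _ _ _ stop) => //.
(* The choice of radius gives [c * (delta / c) = delta]. *)
by have := Nc _ eps_gt0; rewrite mulrCA mulfV ?gt_eqF// mulr1.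
Qed.
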